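(* Let $\mathbf{k}$ be a field and $f(x)=x^N+u_{N-1}x^{N-1}+\dots+u_0\in\mathbf{k}[x]$ a separable polynomial irreducible over $\mathbf{k}$, with splitting field $K$ over $\mathbf{k}$ and roots $\alpha_1,\dots,\alpha_N\in K$. Let $R=\mathbb{Z}[x_1,\dots,x_N]^{S_N}=\mathbb{Z}[E_1,\dots,E_N]$ and let $\phi:R\to\mathbf{k}$ be the ring homomorphism $\phi(E_i)=(-1)^iu_{N-i}$. Let $\phi_1:\mathbb{Z}[x_1,\dots,x_N]\to K$ be the ring homomorphism $\phi_1(x_i)=\alpha_i$, which extends $\phi$. Then $\phi_1$ induces a surjective homomorphism of $\mathbf{k}$-algebras $$\widetilde{\phi}:\ \langle\Gamma_{(1^N)}\rangle_\phi\to K,$$ where $\langle\Gamma_{(1^N)}\rangle_\phi=\mathbb{Z}[x_1,\dots,x_N]\otimes_R\mathbf{k}$. The map $\widetilde{\phi}$ is an isomorphism if and only if the Galois group of $K/\mathbf{k}$ is the symmetric group $S_N$.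
   Context: $E_k$ denotes the $k$-th elementary symmetric polynomial in the variables $x_1,\dots,x_N$. For a sequence $\underline{a}=(a_1,\dots,a_k)$ of positive integers with sum $N$, $\Gamma_{\underline a}$ is the generalized theta-web in $GL(N)$ foam theory in which lines of thickness $a_1,\dots,a_k$ merge into a line of thickness $N$ that goes around and splits back into these lines; its state space is the $R$-algebra $\langle\Gamma_{\underline a}\rangle\cong\mathbb{Z}[x_1,\dots,x_N]^{S_{\underline a}}$, $S_{\underline a}=S_{a_1}\times\dots\times S_{a_k}\subset S_N$. In particular, for $(1^N)=(1,\dots,1)$ it is $\mathbb{Z}[x_1,\dots,x_N]$. The base-changed state space is $\langle\Gamma_{\underline a}\rangle_\phi:=\langle\Gamma_{\underline a}\rangle\otimes_R\mathbf{k}$, with $\mathbf{k}$ an $R$-algebra via $\phi$. ''The Galois group is the symmetric group $S_N$'' means that $\mathrm{Gal}(K/\mathbf{k})$ acts on the roots as the full group of permutations of $\{\alpha_1,\dots,\alpha_N\}$. *)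

(* Defs.v *)
From HB Require Import structures.
From Stdlib Require Import ClassicalEpsilon.
From mathcomp Require Import all_boot all_order all_algebra.
From mathcomp Require Import all_fingroup all_solvable all_field.
From mathcomp Require Import mpoly.

Set Implicit Arguments.
Unset Strict Implicit.
Unset Printing Implicit Defensive.

Import GRing.Theory.
Local Open Scope ring_scope.
Local Open Scope quotient_scope.

(* The tensor product of commutative rings A (x)_R0 B, along fA : R0 -> A and
   fB : R0 -> B.  A list of pairs stands for the formal sum of its entries, and
   tensor_rel is the congruence generated by the defining relations.  Formal
   differences are not needed: (- a, b) is an inverse of (a, b), because (0, b)
   is identified with the empty sum. *)
Section TensorProduct.

Variables (R0 A B : comPzRingType).
Variables (fA : {rmorphism R0 -> A}) (fB : {rmorphism R0 -> B}).

Inductive tensor_rel : seq (A * B) -> seq (A * B) -> Prop :=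
| Tensor_refl s : tensor_rel s s
| Tensor_sym s t : tensor_rel s t -> tensor_rel t s
| Tensor_trans s t w : tensor_rel s t -> tensor_rel t w -> tensor_rel s w
| Tensor_cat s s' t t' :
    tensor_rel s s' -> tensor_rel t t' -> tensor_rel (s ++ t) (s' ++ t')
| Tensor_comm s t : tensor_rel (s ++ t) (t ++ s)
| Tensor_zero b : tensor_rel [:: (0, b)] [::]
| Tensor_addl a a' b : tensor_rel [:: (a + a', b)] [:: (a, b); (a', b)]
| Tensor_addr a b b' : tensor_rel [:: (a, b + b')] [:: (a, b); (a, b')]
| Tensor_balance r a b : tensor_rel [:: (fA r * a, b)] [:: (a, fB r * b)].

Definition tensor_relb : rel (seq (A * B)) :=
  fun s t => if excluded_middle_informative (tensor_rel s t) then true else false.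

Lemma tensor_relP s t : reflect (tensor_rel s t) (tensor_relb s t).
Proof.
by rewrite /tensor_relb; case: excluded_middle_informative => h; constructor.
Qed.

Lemma tensor_relb_equiv : equiv_class_of tensor_relb.
Proof.
split=> [s|s t|t s w].
- exact/tensor_relP/Tensor_refl.
- by apply/tensor_relP/tensor_relP; apply: Tensor_sym.
- by move=> /tensor_relP st /tensor_relP tw; apply/tensor_relP/(Tensor_trans st).
Qed.

Canonical tensor_equiv := EquivRelPack tensor_relb_equiv.

Definition tensor : Type := {eq_quot tensor_equiv}.

HB.instance Definition _ := Choice.on tensor.

Definition tensor_class (s : seq (A * B)) : tensor := \pi_{eq_quot tensor_equiv} s.
Definition tensor_repr (x : tensor) : seq (A * B) :=
  @generic_quotient.repr _ {eq_quot tensor_equiv} x.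

Lemma tensor_reprK x : tensor_class (tensor_repr x) = x.
Proof. exact: reprK. Qed.

Lemma tensor_classP s t : tensor_class s = tensor_class t <-> tensor_rel s t.
Proof.
split=> [st|/tensor_relP st]; last exact/(@eqmodP _ tensor_equiv).
by apply/tensor_relP; apply/(@eqmodP _ tensor_equiv).
Qed.

Lemma tensor_repr_class s : tensor_rel (tensor_repr (tensor_class s)) s.
Proof. by apply/tensor_classP; rewrite tensor_reprK. Qed.

Definition tensor_add (x y : tensor) :=
  tensor_class (tensor_repr x ++ tensor_repr y).
Definition tensor_opp (x : tensor) :=
  tensor_class [seq (- p.1, p.2) | p <- tensor_repr x].

Lemma tensor_add_class s t :
  tensor_add (tensor_class s) (tensor_class t) = tensor_class (s ++ t).
Proof. by apply/tensor_classP/Tensor_cat; apply: tensor_repr_class. Qed.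

Lemma tensor_addA : associative tensor_add.
Proof.
move=> x y z; rewrite -(tensor_reprK x) -(tensor_reprK y) -(tensor_reprK z).
by rewrite !tensor_add_class catA.
Qed.

Lemma tensor_addC : commutative tensor_add.
Proof. by move=> x y; apply/tensor_classP/Tensor_comm. Qed.

Lemma tensor_add0 : left_id (tensor_class [::]) tensor_add.
Proof. by move=> x; rewrite -(tensor_reprK x) tensor_add_class. Qed.

Lemma tensor_addN : left_inverse (tensor_class [::]) tensor_opp tensor_add.
Proof.
move=> x; rewrite /tensor_opp -{2}(tensor_reprK x) tensor_add_class.
apply/tensor_classP; elim: (tensor_repr x) => [|[a b] s IHs] /=.
  exact: Tensor_refl.
set s' := map _ s in IHs *.
have h1 : tensor_rel (s' ++ (a, b) :: s) ((a, b) :: s ++ s').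
  exact: Tensor_comm s' ((a, b) :: s).
have h2 : tensor_rel ((a, b) :: s ++ s') [:: (a, b)].
  apply: (Tensor_cat (Tensor_refl [:: (a, b)]) (t' := [::])).
  exact: Tensor_trans (Tensor_comm s s') IHs.
apply: Tensor_trans (Tensor_cat (Tensor_refl [:: (- a, b)]) (Tensor_trans h1 h2)) _.
apply: Tensor_trans (Tensor_sym (Tensor_addl (- a) a b)) _.
by rewrite addNr; apply: Tensor_zero.
Qed.

HB.instance Definition _ :=
  GRing.isZmodule.Build tensor tensor_addA tensor_addC tensor_add0 tensor_addN.

Definition pure_tensor (a : A) (b : B) : tensor := tensor_class [:: (a, b)].

Lemma tensor_classE s : tensor_class s = \sum_(p <- s) pure_tensor p.1 p.2.
Proof.
elim: s => [|[a b] s IHs]; first by rewrite big_nil.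
by rewrite big_cons -IHs [RHS]tensor_add_class.
Qed.

Lemma tensorE x : x = \sum_(p <- tensor_repr x) pure_tensor p.1 p.2.
Proof. by rewrite -tensor_classE tensor_reprK. Qed.

Lemma pure_tensorDl a a' b :
  pure_tensor (a + a') b = pure_tensor a b + pure_tensor a' b.
Proof.
have /tensor_classP := Tensor_addl a a' b.
by rewrite -(tensor_add_class [:: (a, b)] [:: (a', b)]).
Qed.

Lemma pure_tensorDr a b b' :
  pure_tensor a (b + b') = pure_tensor a b + pure_tensor a b'.
Proof.
have /tensor_classP := Tensor_addr a b b'.
by rewrite -(tensor_add_class [:: (a, b)] [:: (a, b')]).
Qed.

Lemma pure_tensor_balance r a b :
  pure_tensor (fA r * a) b = pure_tensor a (fB r * b).
Proof. exact/tensor_classP/Tensor_balance. Qed.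

Definition balanced (G : zmodType) (h : A -> B -> G) :=
  [/\ forall a a' b, h (a + a') b = h a b + h a' b,
      forall a b b', h a (b + b') = h a b + h a b'
    & forall r a b, h (fA r * a) b = h a (fB r * b)].

Lemma balanced_sum (G : zmodType) (h : A -> B -> G) s t :
  balanced h -> tensor_rel s t ->
  \sum_(p <- s) h p.1 p.2 = \sum_(p <- t) h p.1 p.2.
Proof.
case=> hDl hDr hb; elim=> //= {s t}.
- by move=> s t w _ -> _ ->.
- by move=> s s' t t' _ es _ et; rewrite !big_cat es et.
- by move=> s t; rewrite !big_cat /= addrC.
- move=> b; rewrite big_seq1 big_nil /=; apply: (addrI (h 0 b)).
  by rewrite -hDl !addr0.
- by move=> a a' b; rewrite !big_cons !big_nil /= hDl !addr0.
- by move=> a b b'; rewrite !big_cons !big_nil /= hDr !addr0.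
- by move=> r a b; rewrite !big_seq1 /= hb.
Qed.

Definition tensor_ext (G : zmodType) (h : A -> B -> G) (x : tensor) : G :=
  \sum_(p <- tensor_repr x) h p.1 p.2.

Lemma tensor_ext_pure (G : zmodType) (h : A -> B -> G) a b :
  balanced h -> tensor_ext h (pure_tensor a b) = h a b.
Proof.
by move=> hh; rewrite /tensor_ext (balanced_sum hh (tensor_repr_class _)) big_seq1.
Qed.

Lemma tensor_extD (G : zmodType) (h : A -> B -> G) x y :
  balanced h -> tensor_ext h (x + y) = tensor_ext h x + tensor_ext h y.
Proof.
move=> hh; rewrite /tensor_ext -big_cat.
exact: balanced_sum hh (tensor_repr_class _).
Qed.

Lemma tensor_ind (P : tensor -> Prop) :
  (forall a b, P (pure_tensor a b)) -> (forall x y, P x -> P y -> P (x + y)) ->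
  forall x, P x.
Proof.
move=> Pp PD x; rewrite (tensorE x); apply: big_ind => //.
suff <- : pure_tensor 0 0 = 0 by [].
by apply: (addrI (pure_tensor 0 0)); rewrite -pure_tensorDl !addr0.
Qed.

Definition tensor_one : tensor := pure_tensor 1 1.

Definition tensor_mul (x y : tensor) : tensor :=
  tensor_ext (fun a b => tensor_ext (fun a' b' => pure_tensor (a * a') (b * b')) y) x.

Definition tensor_scale (c : B) (x : tensor) : tensor :=
  tensor_ext (fun a b => pure_tensor a (c * b)) x.

Lemma balanced_mulr a b :
  balanced (fun a' b' => pure_tensor (a * a') (b * b')).
Proof.
split=> [a1 a2 b1|a1 b1 b2|r a1 b1]; rewrite ?mulrDr ?pure_tensorDl ?pure_tensorDr //.
by rewrite mulrCA pure_tensor_balance mulrCA.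
Qed.

Lemma balanced_mull y :
  balanced (fun a b => tensor_ext (fun a' b' => pure_tensor (a * a') (b * b')) y).
Proof.
split=> [a a' b|a b b'|r a b]; rewrite /tensor_ext -?big_split /=;
  apply: eq_bigr => p _.
- by rewrite mulrDl pure_tensorDl.
- by rewrite mulrDl pure_tensorDr.
- by rewrite -!mulrA pure_tensor_balance.
Qed.

Lemma balanced_scale c : balanced (fun a b => pure_tensor a (c * b)).
Proof.
split=> [a a' b|a b b'|r a b]; rewrite ?mulrDr ?pure_tensorDl ?pure_tensorDr //.
by rewrite pure_tensor_balance mulrCA.
Qed.

Lemma tensor_mul_pure a b a' b' :
  tensor_mul (pure_tensor a b) (pure_tensor a' b') = pure_tensor (a * a') (b * b').
Proof.
by rewrite /tensor_mul (tensor_ext_pure _ _ (balanced_mull _)) (tensor_ext_pure _ _ (balanced_mulr _ _)).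
Qed.

Lemma tensor_mulDl : left_distributive tensor_mul +%R.
Proof. by move=> x y z; apply: tensor_extD (balanced_mull _). Qed.

Lemma tensor_mulC : commutative tensor_mul.
Proof.
move=> x y; rewrite /tensor_mul /tensor_ext exchange_big /=.
by apply: eq_bigr => p _; apply: eq_bigr => q _; rewrite mulrC [_.2 * _]mulrC.
Qed.

Lemma tensor_mulDr x y z : tensor_mul x (y + z) = tensor_mul x y + tensor_mul x z.
Proof. by rewrite tensor_mulC tensor_mulDl !(tensor_mulC x). Qed.

Lemma tensor_mulA : associative tensor_mul.
Proof.
elim/tensor_ind=> [a b|x x' IHx IHx'] y z; last first.
  by rewrite !tensor_mulDl IHx IHx'.
elim/tensor_ind: y => [a' b'|y y' IHy IHy']; last first.
  by rewrite tensor_mulDl !tensor_mulDr tensor_mulDl IHy IHy'.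
elim/tensor_ind: z => [a'' b''|z z' IHz IHz']; last first.
  by rewrite !tensor_mulDr IHz IHz'.
by rewrite !tensor_mul_pure !mulrA.
Qed.

Lemma tensor_mul1 : left_id tensor_one tensor_mul.
Proof.
elim/tensor_ind=> [a b|x y IHx IHy]; last by rewrite tensor_mulDr IHx IHy.
by rewrite tensor_mul_pure !mul1r.
Qed.

HB.instance Definition _ := GRing.Zmodule_isComPzRing.Build tensor
  tensor_mulA tensor_mulC tensor_mul1 tensor_mulDl.

Lemma tensor_scale_pure c a b :
  tensor_scale c (pure_tensor a b) = pure_tensor a (c * b).
Proof. exact: tensor_ext_pure (balanced_scale c). Qed.

Lemma tensor_scaleDr : right_distributive tensor_scale +%R.
Proof. by move=> c x y; apply: tensor_extD (balanced_scale c). Qed.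

Lemma tensor_scaleA c d x :
  tensor_scale c (tensor_scale d x) = tensor_scale (c * d) x.
Proof.
elim/tensor_ind: x => [a b|x y IHx IHy]; last by rewrite !tensor_scaleDr IHx IHy.
by rewrite !tensor_scale_pure mulrA.
Qed.

Lemma tensor_scale1 : left_id 1 tensor_scale.
Proof.
elim/tensor_ind=> [a b|x y IHx IHy]; last by rewrite tensor_scaleDr IHx IHy.
by rewrite tensor_scale_pure mul1r.
Qed.

Lemma tensor_scaleDl x : {morph tensor_scale^~ x : c d / c + d}.
Proof.
move=> c d; elim/tensor_ind: x => [a b|x y IHx IHy].
  by rewrite !tensor_scale_pure mulrDl pure_tensorDr.
by rewrite !tensor_scaleDr IHx IHy addrACA.
Qed.

HB.instance Definition _ := GRing.Zmodule_isLmodule.Build B tensor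
  tensor_scaleA tensor_scale1 tensor_scaleDr tensor_scaleDl.

(* tensor may be the zero ring, so it is a commutative B-algebra only in this
   unbundled form: lalgType requires 1 != 0. *)
Lemma tensor_scalerAl (c : B) (x y : tensor) : c *: (x * y) = (c *: x) * y.
Proof.
elim/tensor_ind: x => [a b|x x' IHx IHx']; last first.
  by rewrite mulrDl !scalerDr mulrDl IHx IHx'.
elim/tensor_ind: y => [a' b'|y y' IHy IHy']; last first.
  by rewrite !mulrDr scalerDr IHy IHy'.
have mulE := tensor_mul_pure; rewrite /GRing.scale /= /GRing.mul /=.
by rewrite mulE !tensor_scale_pure mulE mulrA.
Qed.

Lemma tensor_universal (S : comPzRingType)
    (h : {rmorphism A -> S}) (g : {rmorphism B -> S}) :
  (forall r, h (fA r) = g (fB r)) ->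
  exists2 F : {rmorphism tensor -> S},
    (forall a b, F (pure_tensor a b) = h a * g b)
  & forall F' : {rmorphism tensor -> S},
      (forall a, F' (pure_tensor a 1) = h a) ->
      (forall b, F' (pure_tensor 1 b) = g b) -> F' =1 F.
Proof.
move=> hg; pose m a b := h a * g b.
have bm : balanced m.
  split=> *; rewrite /m ?rmorphD ?rmorphM ?mulrDl ?mulrDr //.
  by rewrite hg mulrCA mulrA.
have F1 a b : tensor_ext m (pure_tensor a b) = m a b by apply: tensor_ext_pure.
have FD x y : tensor_ext m (x + y) = tensor_ext m x + tensor_ext m y.
  exact: tensor_extD.
have F0 : tensor_ext m 0 = 0 by apply: (addrI (tensor_ext m 0)); rewrite -FD !addr0.
have FM : monoid_morphism (tensor_ext m).
  split; first by rewrite F1 /m !rmorph1 mulr1.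
  elim/tensor_ind=> [a b|x x' IHx IHx'] y; last by rewrite mulrDl !FD IHx IHx' mulrDl.
  elim/tensor_ind: y => [a' b'|y y' IHy IHy']; last by rewrite mulrDr !FD IHy IHy' mulrDr.
  rewrite !F1 [_ * _ in LHS]tensor_mul_pure F1 /m !rmorphM.
  by rewrite mulrACA.
pose i1 := GRing.isNmodMorphism.Build _ _ (tensor_ext m) (conj F0 FD).
pose i2 := GRing.isMonoidMorphism.Build _ _ (tensor_ext m) FM.
pose F : {rmorphism tensor -> S} :=
  HB.pack_for {rmorphism tensor -> S} (tensor_ext m) i1 i2.
exists F => [a b|F' F'A F'B]; first exact: F1.
elim/tensor_ind=> [a b|x y IHx IHy]; last by rewrite !rmorphD IHx IHy.
have -> : pure_tensor a b = pure_tensor a 1 * pure_tensor 1 b.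
  by rewrite [RHS]tensor_mul_pure mulr1 mul1r.
by rewrite !rmorphM F'A F'B [X in _ = X * _]F1 [X in _ = _ * X]F1 /m !rmorph1 mulr1 mul1r.
Qed.

End TensorProduct.

Arguments pure_tensor {R0 A B} fA fB a b.

Section SymmetricPolynomials.

Variable N : nat.

Definition sympoly : Type := {p : {mpoly int[N]} | p \is symmetric}.

HB.instance Definition _ := SubChoice.on sympoly.
HB.instance Definition _ :=
  [SubChoice_isSubComNzRing of sympoly by <:].

Definition elem_sym (i : nat) : sympoly := Sub (mesym N int i) (mesym_sym N int i).

End SymmetricPolynomials.

Definition sympoly_incl (N : nat) : {rmorphism sympoly N -> {mpoly int[N]}} :=
  (val : sympoly N -> {mpoly int[N]}).

(* Z[x_1, ..., x_N]^(S_N) is the polynomial ring Z[E_1, ..., E_N]. *)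
Lemma sympoly_rmorphism_exists (N : nat) (S : comNzRingType) (v : nat -> S) :
  exists phi : {rmorphism sympoly N -> S},
    forall i : nat, (1 <= i <= N)%N -> phi (elem_sym N i) = v i.
Proof.
pose E := [tuple mesym N int i.+1 | i < N].
pose T (p : sympoly N) : {mpoly int[N]} := sval (sym_fundamental (valP p)).
have TE p : T p \mPo E = val p by rewrite /T; case: sym_fundamental => t [].
have T_uniq p t : t \mPo E = val p -> T p = t.
  by move=> tE; apply: msym_fundamental_un; rewrite [LHS]TE -tE.
pose w (i : 'I_N) := v i.+1.
pose F (p : sympoly N) := mmap intr w (T p).
have F0 : F 0 = 0 by rewrite /F (T_uniq 0 0) ?rmorph0.
have FD p q : F (p + q) = F p + F q.
  by rewrite /F (T_uniq _ (T p + T q)) ?rmorphD //= !TE.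
have FM : monoid_morphism F.
  split; first by rewrite /F (T_uniq 1 1) ?rmorph1.
  by move=> p q; rewrite /F (T_uniq _ (T p * T q)) ?rmorphM //= !TE.
pose i1 := GRing.isNmodMorphism.Build _ _ F (conj F0 FD).
pose i2 := GRing.isMonoidMorphism.Build _ _ F FM.
exists (HB.pack_for {rmorphism sympoly N -> S} F i1 i2) => -[//|i] /= ltiN.
rewrite /F (T_uniq _ 'X_(Ordinal ltiN)).
  by rewrite mmapX mmap1U.
by rewrite comp_mpolyXU -tnth_nth tnth_mktuple.
Qed.

(* Base change along phi : Z[x_1, ..., x_N]^(S_N) -> k of the state space
   Z[x_1, ..., x_N] of the theta-web with N strands of thickness 1. *)
Notation theta_state phi := (tensor (sympoly_incl _) phi).

Notation theta_pure phi p c := (pure_tensor (sympoly_incl _) phi p c).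

(* For pairwise distinct alpha_i, every permutation of {alpha_1, ..., alpha_N}
   is alpha_i |-> alpha_(s i) for exactly one s : 'S_N. *)
Definition galois_full_symmetric (N : nat) (k : fieldType)
    (K : splittingFieldType k) (alpha : 'I_N -> K) : Prop :=
  forall s : 'S_N,
    exists2 g, g \in 'Gal({:K} / 1)%g & forall i, g (alpha i) = alpha (s i).

(* Main.v *)
From HB Require Import structures.
Require Import Defs.
From mathcomp Require Import all_boot all_order all_algebra.
From mathcomp Require Import all_fingroup all_solvable all_field.
From mathcomp Require Import mpoly.

Set Implicit Arguments.
Unset Strict Implicit.
Unset Printing Implicit Defensive.

Import GRing.Theory.
Local Open Scope ring_scope.

(* Write A for the tensor product, on which S_N acts by permuting the x_i. If
   phi~ is bijective, this action transports to K. Conversely suppose the Galois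
   group is S_N. The kernel of phi~ is then S_N-stable, since permuting the x_i
   becomes a Galois automorphism after phi~, and traces from A to k vanish on it
   because they are scalars that phi~ kills. But the trace form on A is
   nondegenerate once prod_(i <> j) (alpha_i - alpha_j) is nonzero, which is
   separability; no basis of A over k is needed to see this. *)

(** * Ring homomorphisms out of polynomials and symmetric polynomials *)

Lemma mpoly_int_rmorph_eq (n : nat) (S : nzRingType)
    (F G : {rmorphism {mpoly int[n]} -> S}) :
  (forall i, F 'X_i = G 'X_i) -> F =1 G.
Proof.
move=> FG p; rewrite [p]mpolyE !rmorph_sum; apply: eq_bigr => m _ /=.
rewrite -mul_mpolyC !rmorphM /= -[p@_m]intz !rmorph_int.
congr (_ * _); rewrite mpolyXE_id !rmorph_prod; apply: eq_bigr => i _ /=.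
by rewrite !rmorphXn /= FG.
Qed.

(** The fundamental theorem writes [p] as an integer polynomial [t] in the elementary symmetric
    ones, so the values there determine the homomorphism. *)
Lemma sympoly_rmorph_eq (n : nat) (S : nzRingType)
    (F G : {rmorphism sympoly n -> S}) :
  (forall i : nat, (1 <= i <= n)%N -> F (elem_sym n i) = G (elem_sym n i)) ->
  F =1 G.
Proof.
move=> FG p.
have [t [tp _]] := sym_fundamental (valP p).
(* Variables are numbered from 0, so ['X_i] goes to degree [i.+1]. *)
pose E (i : 'I_n) := elem_sym n i.+1.
have -> : p = mmap intr E t.
  apply: val_inj; rewrite -[LHS]tp.
  have := @mpoly_int_rmorph_eq n _
    (comp_mpoly [tuple mesym n int i.+1 | i < n]) (val \o mmap intr E).
  apply=> i /=; rewrite comp_mpolyXU -tnth_nth tnth_mktuple.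
  by rewrite mmapX mmap1U.
have := @mpoly_int_rmorph_eq n S (F \o mmap intr E) (G \o mmap intr E).
apply=> i /=; rewrite mmapX mmap1U FG //=; exact: ltn_ord.
Qed.

(** Vieta's formula over the integers, carried along [h]. It is what makes [phi1] extend [phi]. *)
Lemma mesym_roots (n : nat) (S : comNzRingType) (g : {poly S})
    (a : 'I_n -> S) (h : {rmorphism {mpoly int[n]} -> S}) (i : nat) :
  g = \prod_(j < n) ('X - (a j)%:P) -> (forall j, h 'X_j = a j) -> (i <= n)%N ->
  h (mesym n int i) = (-1) ^+ i * g`_(n - i).
Proof.
move=> -> ha lein; have /(congr1 (map_poly h)) := Viete n.
rewrite rmorph_prod /= (eq_bigr (fun j => 'X - (a j)%:P)); last first.
  by move=> j _; rewrite rmorphB /= map_polyX map_polyC /= ha.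
move=> ->; rewrite [map_poly _ _]raddf_sum coef_sum /=.
rewrite (bigD1 (Ordinal (lein : i < n.+1)%N)) //=.
rewrite big1 => [|j neji]; rewrite !map_polyZ map_polyXn !coefZ coefXn.
  by rewrite eqxx mulr1 addr0 rmorphXn rmorphN1 mulrA -expr2 sqrr_sign mul1r.
case: eqP => [e|_]; last by rewrite !mulr0.
case/eqP: neji; apply: val_inj => /=.
by apply/eqP; rewrite -(eqn_sub2lE _ lein) ?e // -ltnS.
Qed.

Lemma msymXU (n : nat) (S : nzRingType) (s : 'S_n) (i : 'I_n) :
  msym s 'X_i = 'X_(s i) :> {mpoly S[n]}.
Proof. by rewrite /msym mmapX mmap1U. Qed.

(** * The action of S_N on the tensor product, its trace and the discriminant *)

Section Permutations.

Variables (N : nat) (B : comNzRingType) (phi : {rmorphism sympoly N -> B}).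

Local Notation T := (theta_state phi).
Local Notation pure p c := (theta_pure phi p c).

Definition theta_perm (s : 'S_N) (x : T) : T :=
  tensor_ext (fun p c => pure (msym s p) c) x.

(** Symmetric polynomials are fixed by [msym s], so permuting the variables descends to the tensor
    product. *)
Lemma balanced_theta_perm (s : 'S_N) :
  balanced (sympoly_incl N) phi (fun p c => pure (msym s p) c).
Proof.
split=> [p q c|p c d|r p c]; rewrite ?msymD ?pure_tensorDl ?pure_tensorDr //.
by rewrite msymM (issymP _ (valP r)) pure_tensor_balance.
Qed.

Lemma theta_perm_pure s p c : theta_perm s (pure p c) = pure (msym s p) c.
Proof. exact: tensor_ext_pure (balanced_theta_perm s). Qed.

Lemma theta_permD s x y : theta_perm s (x + y) = theta_perm s x + theta_perm s y.
Proof. exact: tensor_extD (balanced_theta_perm s). Qed.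

Lemma theta_pureM p c q d : pure p c * pure q d = pure (p * q) (c * d).
Proof. exact: tensor_mul_pure. Qed.

Lemma theta_pure0l c : pure 0 c = 0.
Proof. by apply: (addrI (pure 0 c)); rewrite -pure_tensorDl !addr0. Qed.

Lemma theta_pure0r p : pure p 0 = 0.
Proof. by apply: (addrI (pure p 0)); rewrite -pure_tensorDr !addr0. Qed.

Lemma theta_permM s x y : theta_perm s (x * y) = theta_perm s x * theta_perm s y.
Proof.
elim/tensor_ind: x => [p c|x x' IHx IHx']; last first.
  by rewrite mulrDl !theta_permD IHx IHx' mulrDl.
elim/tensor_ind: y => [q d|y y' IHy IHy']; last first.
  by rewrite mulrDr !theta_permD IHy IHy' mulrDr.
by rewrite theta_pureM !theta_perm_pure theta_pureM msymM.
Qed.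

Lemma theta_perm1 x : theta_perm 1 x = x.
Proof.
elim/tensor_ind: x => [p c|x y IHx IHy]; last by rewrite theta_permD IHx IHy.
by rewrite theta_perm_pure msym1m.
Qed.

(** On a pure tensor the sum of all permuted copies of [p] is symmetric, so it crosses the tensor
    sign and becomes a scalar. *)
Lemma theta_perm_sum_scalar x : exists c, \sum_s theta_perm s x = pure 1 c.
Proof.
elim/tensor_ind: x => [p c|x y [c IHx] [d IHy]]; last first.
  exists (c + d); rewrite pure_tensorDr -IHx -IHy -big_split /=.
  by apply: eq_bigr => s _; rewrite theta_permD.
have sym_p : \sum_(s : 'S_N) msym s p \is symmetric.
  apply/issymP => t; rewrite (big_morph _ (msymD t) (msym0 _ t)).
  rewrite [RHS](reindex_inj (mulIg t)).
  by apply: eq_bigr => s _; rewrite msymMm.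
pose q : sympoly N := Sub (\sum_(s : 'S_N) msym s p) sym_p.
exists (phi q * c); rewrite -pure_tensor_balance mulr1 /=.
have pure_sum : {morph (fun p1 => pure p1 c) : q1 q2 / q1 + q2 >-> q1 + q2}.
  by move=> q1 q2; apply: pure_tensorDl.
rewrite (big_morph _ pure_sum (theta_pure0l c)).
by apply: eq_bigr => s _; rewrite theta_perm_pure.
Qed.

Definition theta_diff (i j : 'I_N) : T := pure ('X_i - 'X_j) 1.

(* The product over i <> j of 'X_i - 'X_(s j) is the discriminant if s = 1 and
   vanishes otherwise. Expanding it factor by factor therefore writes
   x * discriminant as a combination of traces of multiples of x. *)
Lemma theta_trace_nondegenerate x :
  (forall y, \sum_s theta_perm s (x * y) = 0) ->
  x * \prod_(ij : 'I_N * 'I_N | ij.1 != ij.2) theta_diff ij.1 ij.2 = 0.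
Proof.
have diffE (s : 'S_N) i j :
    theta_diff i (s j) = pure 'X_i 1 - theta_perm s (pure 'X_j 1).
  apply: (addIr (theta_perm s (pure 'X_j 1))); rewrite subrK.
  by rewrite theta_perm_pure msymXU -pure_tensorDl subrK.
move=> trx.
(* Induction on [r] with [y] free: in the factor [X_i - X_(s j)], the term [X_i] leaves the sum over
   [s], while [X_(s j)], the image of [X_j] under [s], is absorbed into [y]. *)
have expand (r : seq ('I_N * 'I_N)) : forall y,
    \sum_s theta_perm s (x * y) * \prod_(ij <- r) theta_diff ij.1 (s ij.2) = 0.
  elim: r => [|[i j] r IHr] y.
    by rewrite -[RHS](trx y); apply: eq_bigr => s _; rewrite big_nil mulr1.
  rewrite -[RHS](subrr 0) -[X in _ = X - _](mulr0 (pure 'X_i 1)).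
  rewrite -[X in _ = _ * X - _](IHr y) -[X in _ = _ - X](IHr (y * pure 'X_j 1)).
  rewrite mulr_sumr -sumrB; apply: eq_bigr => s _.
  rewrite big_cons diffE [x * (_ * _)]mulrA !theta_permM.
  by rewrite mulrBl mulrBr; congr (_ - _); [rewrite mulrCA | rewrite mulrA].
have := expand (filter (fun ij => ij.1 != ij.2) (index_enum _)) 1.
rewrite (bigD1 1%g) //= theta_perm1 mulr1 big_filter [X in _ + X]big1 => [|s neqs1].
  rewrite addr0 => <-; congr (_ * _); apply: eq_bigr => ij _.
  by rewrite perm1.
have [j nesj] : exists j, s j != j.
  apply/existsP; rewrite -negb_forall; apply: contra neqs1 => /forallP fix_s.
  by apply/eqP/permP => j; rewrite perm1; apply/eqP.
(* The pair [(s j, j)] is off the diagonal, and its factor is [X_(s j) - X_(s j) = 0]. *)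
rewrite big_filter (bigD1 (s j, j)) //= {1}/theta_diff subrr.
by rewrite theta_pure0l mul0r mulr0.
Qed.

(** Over ordered pairs the product is invariant under permutations, with no sign, so it crosses to
    the scalar side. *)
Lemma theta_disc_scalar :
  exists d, \prod_(ij : 'I_N * 'I_N | ij.1 != ij.2) theta_diff ij.1 ij.2 = pure 1 d.
Proof.
pose disc : {mpoly int[N]} :=
  \prod_(ij : 'I_N * 'I_N | ij.1 != ij.2) ('X_ij.1 - 'X_ij.2).
have sym_disc : disc \is symmetric.
  apply/issymP => s; rewrite /disc (big_morph _ (msymM s) (msym1 _ s)).
  rewrite [RHS](reindex_inj (h := fun ij => (s ij.1, s ij.2))) /=; last first.
    by move=> [i j] [i' j'] /= [/perm_inj -> /perm_inj ->].
  apply: eq_big => [ij|ij _] /=; first by rewrite (inj_eq perm_inj).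
  by rewrite msymB !msymXU.
pose q : sympoly N := Sub disc sym_disc.
exists (phi q); rewrite -[phi q]mulr1 -pure_tensor_balance mulr1 /=.
have pure_prod : {morph (fun p => pure p 1) : p1 p2 / p1 * p2 >-> p1 * p2}.
  by move=> p1 p2; rewrite theta_pureM mulr1.
by rewrite (big_morph _ pure_prod (id1 := 1)).
Qed.

End Permutations.

(** * Generation of splitting fields and Galois automorphisms *)

(** Roots are adjoined one at a time; each new element is a polynomial in the last root over the
    previous field. This serves to prove [phit] surjective. *)
Lemma splitting_field_ind (k : fieldType) (K : splittingFieldType k)
    (g : {poly K}) (P : K -> Prop) :
  splittingFieldFor 1%VS g {:K}%VS ->
  (forall c, P c%:A) -> (forall y, root g y -> P y) ->
  (forall y z, P y -> P z -> P (y + z)) -> (forall y z, P y -> P z -> P (y * z)) ->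
  forall y, P y.
Proof.
move=> [rs g_rs gen_rs] PA Pg PD PM.
have {g_rs}: {subset rs <= root g}.
  by move=> y rs_y; rewrite -topredE /= (eqp_root g_rs) root_prod_XsubC.
move=> rs_g y; move: (memvf y); rewrite -gen_rs => {gen_rs}.
elim/last_ind: rs rs_g y => [|rs z IHrs] rs_g y.
  by rewrite Fadjoin_nil => /vlineP[c ->].
rewrite adjoin_rcons => /Fadjoin_polyP[p /polyOverP p_rs ->].
have Pz : P z by apply/Pg/rs_g; rewrite mem_rcons mem_head.
have Pp i : P p`_i.
  by apply: IHrs (p_rs i) => w rs_w; apply: rs_g; rewrite mem_rcons in_cons rs_w orbT.
rewrite horner_coef; apply: big_ind => // [|i _]; first by rewrite -(scale0r 1).
apply: (PM _ _ (Pp i)); elim: (val i) => [|m IHm]; first by rewrite expr0 -(scale1r 1).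
by rewrite exprS; apply: PM.
Qed.

(** Such a [t] is k-linear, and a k-linear ring endomorphism of a finite extension is an
    automorphism. *)
Lemma rmorph_gal (k : fieldType) (K : splittingFieldType k)
    (t : {rmorphism K -> K}) :
  (forall c, t c%:A = c%:A) ->
  exists2 g, g \in 'Gal({:K} / 1)%g & forall y, g y = t y.
Proof.
move=> tA.
have tZ : scalable t by move=> c y; rewrite -mulr_algl rmorphM /= tA mulr_algl.
pose tl : {linear K -> K} := HB.pack_for {linear K -> K} (t : K -> K)
  (GRing.isScalable.Build _ _ _ _ _ tZ) (GRing.RMorphism.on t).
have aut_t : kAut 1 {:K} (linfun tl).
  rewrite kAutfE; apply/kHom_monoid_morphism; split=> [|y z].
    by rewrite lfunE /= rmorph1.
  by rewrite !lfunE /= rmorphM.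
have [g Gg gt] := kAut_to_gal aut_t.
by exists g => // y; rewrite -gt ?memvf ?lfunE.
Qed.

(** * Construction of [phit] and the criterion for its bijectivity *)

Theorem proposition6p1 (N : nat) (k : fieldType) (f : {poly k})
    (f_monic : f \is monic) (f_deg : size f = N.+1)
    (f_sep : separable_poly f) (f_irr : irreducible_poly f)
    (K : splittingFieldType k)
    (K_split : splittingFieldFor 1%VS (map_poly (in_alg K) f) {:K}%VS)
    (alpha : 'I_N -> K)
    (f_roots : map_poly (in_alg K) f = \prod_(i < N) ('X - (alpha i)%:P))
    (phi : {rmorphism sympoly N -> k})
    (phiE : forall i : nat, (1 <= i <= N)%N ->
       phi (elem_sym N i) = (-1) ^+ i * f`_(N - i))
    (phi1 : {rmorphism {mpoly int[N]} -> K})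
    (phi1X : forall i : 'I_N, phi1 'X_i = alpha i) :
  (forall p : sympoly N, phi1 (sympoly_incl N p) = (phi p)%:A) /\
  exists phit : {rmorphism theta_state phi -> K},
    [/\ scalable phit,
        forall p c, phit (theta_pure phi p c) = c *: phi1 p,
        forall y : K, exists x, phit x = y
      & bijective phit <-> galois_full_symmetric alpha].
Proof.
have phi1_sym (p : sympoly N) : phi1 (sympoly_incl N p) = (phi p)%:A.
  apply: (@sympoly_rmorph_eq _ _ (phi1 \o sympoly_incl N) (in_alg K \o phi)).
  move=> i /andP[i_gt0 leiN] /=.
  rewrite (mesym_roots f_roots phi1X leiN) phiE ?i_gt0 // coef_map.
  by rewrite -[RHS]/(in_alg K _) rmorphM rmorphXn rmorphN1.
split=> //.
have [phit phitE _] := tensor_universal (h := phi1) (g := in_alg K) phi1_sym.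
have phitP p c : phit (theta_pure phi p c) = c *: phi1 p.
  by rewrite phitE /= mulr_algr.
have phit_scale : scalable phit.
  move=> c x; elim/tensor_ind: x => [p d|x y IHx IHy].
    by rewrite [c *: _]tensor_scale_pure !phitP scalerA.
  by rewrite scalerDr !rmorphD scalerDr IHx IHy.
have phit_surj y : exists x, phit x = y.
  move: y; apply: (splitting_field_ind K_split).
  - by move=> c; exists (theta_pure phi 1 c); rewrite phitP rmorph1.
  - move=> y; rewrite f_roots rootE horner_prod => /prodf_eq0[i _].
    rewrite hornerXsubC subr_eq0 => /eqP ->.
    by exists (theta_pure phi 'X_i 1); rewrite phitP phi1X scale1r.
  - by move=> _ _ [x <-] [y <-]; exists (x + y); rewrite rmorphD.
  - by move=> _ _ [x <-] [y <-]; exists (x * y); rewrite rmorphM.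
exists phit; split=> //; split=> [[psi phitK psiK] s | gal_full].
  (* Permuting the variables first still restricts to [phi], which yields [tau] sending [x_i] to
     [alpha (s i)]; then [tau] after the inverse of [phit] is the desired automorphism. *)
  have phi1s_sym (p : sympoly N) : phi1 (msym s (sympoly_incl N p)) = (phi p)%:A.
    by rewrite (issymP _ (valP p)) phi1_sym.
  have [tau tauE _] := tensor_universal (h := phi1 \o msym s) (g := in_alg K) phi1s_sym.
  have psiM : monoid_morphism psi.
    by split=> [|x y]; apply: (can_inj phitK); rewrite ?rmorphM !psiK ?rmorph1.
  have psiD : psi 0 = 0 /\ {morph psi : x y / x + y}.
    by split=> [|x y]; apply: (can_inj phitK); rewrite ?rmorphD !psiK ?rmorph0.
  pose i1 := GRing.isNmodMorphism.Build _ _ psi psiD.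
  pose i2 := GRing.isMonoidMorphism.Build _ _ psi psiM.
  pose rpsi := HB.pack_for {rmorphism K -> theta_state phi} psi i1 i2.
  have [|g Gg gE] := @rmorph_gal _ _ (tau \o rpsi).
    move=> c /=; rewrite -[c%:A](_ : phit (theta_pure phi 1 c) = _) ?phitK; last first.
      by rewrite phitP rmorph1.
    by rewrite phitP tauE /= msym1 !rmorph1 mul1r.
  exists g => // i; rewrite gE /= -phi1X -[phi1 _]scale1r -phitP phitK tauE /=.
  by rewrite msymXU phi1X scale1r mulr1.
suff phit_inj : injective phit.
  have phit_ex y : exists x, phit x == y by have [x /eqP] := phit_surj y; exists x.
  exists (fun y => xchoose (phit_ex y)) => [x|y].
    exact/phit_inj/eqP/(xchooseP (phit_ex _)).
  exact/eqP/(xchooseP (phit_ex _)).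
apply: raddf_inj => x phitx0.
(* The kernel is stable: through [phit], permuting by [s] becomes the Galois automorphism [g]
   realizing [s]. *)
have phit_perm s y : phit (theta_perm s (x * y)) = 0.
  have [g _ g_alpha] := gal_full s.
  suff phit_s z : phit (theta_perm s z) = g (phit z).
    by rewrite phit_s rmorphM phitx0 mul0r rmorph0.
  elim/tensor_ind: z => [p c|z z' IHz IHz']; last first.
    by rewrite theta_permD !rmorphD IHz IHz'.
  rewrite theta_perm_pure !phitP linearZ /=; congr (_ *: _).
  apply: (@mpoly_int_rmorph_eq _ _ (phi1 \o msym s) (g \o phi1)) => i /=.
  by rewrite msymXU !phi1X g_alpha.
have phit1_inj c : phit (theta_pure phi 1 c) = 0 -> c = 0.
  by rewrite phitP rmorph1 => /eqP; rewrite scaler_eq0 oner_eq0 orbF => /eqP.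
have := theta_trace_nondegenerate (x := x).
have [d discE] := theta_disc_scalar phi; rewrite discE => xd0.
(* [phit] sends the discriminant to the product of the differences of the roots, which are distinct
   by separability. *)
have d_neq0 : d != 0.
  apply/eqP => d0; have : phit (theta_pure phi 1 d) = 0 by rewrite phitP d0 scale0r.
  apply/eqP; rewrite -discE rmorph_prod; apply/prodf_neq0 => -[i j] /= neq_ij.
  rewrite phitP scale1r rmorphB !phi1X subr_eq0; apply: contra neq_ij.
  have : separable_poly (map_poly (in_alg K) f) by rewrite separable_map.
  rewrite f_roots -(big_map alpha xpredT (fun a => 'X - a%:P)).
  rewrite separable_prod_XsubC [index_enum _]unlock -enumT => /injectiveP alpha_inj.
  by move/eqP/alpha_inj ->.
have -> : x = x * theta_pure phi 1 d * theta_pure phi 1 d^-1.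
  by rewrite -mulrA theta_pureM mulr1 divff //; apply/esym/mulr1.
(* The trace of [x * y] is a scalar [c] killed by [phit]; since k embeds in [K], [c] is 0. *)
rewrite xd0 ?mul0r // => y; have [c trE] := theta_perm_sum_scalar (x * y).
rewrite trE (phit1_inj c) ?theta_pure0r // -trE rmorph_sum.
by apply: big1 => s _; apply: phit_perm.
Qed.
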